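(* Let $p$ be an odd prime, let $q\in\mathbb{C}_p$ with $|q-1|_p<1$ and $\log q\neq 0$, let $d$ be a positive integer with $(p,d)=1$, and let $\chi$ be a Dirichlet character with conductor $d$ (with values in $\mathbb{C}_p$). Then for every $n\in\mathbb{N}$ ($n\ge1$), $$\int_{X}\chi(x)\,x^n\,d\mu_q(x)=\frac{q-1}{\log q}\,B_{n,q,\chi}\qquad\text{and}\qquad\int_{\mathbb{Z}_p}x^n\,d\mu_q(x)=\frac{q-1}{\log q}\,B_{n,q}.$$
   Context: $\mathbb{C}_p$ is the completion of the algebraic closure of $\mathbb{Q}_p$, with absolute value normalized by $|p|_p=1/p$, and $\log$ is the $p$-adic logarithm. For an integer $x\ge0$, $[x]_q=\frac{1-q^x}{1-q}$. For a function $g$ on $\mathbb{Z}_p$, $$\int_{\mathbb{Z}_p}g(x)\,d\mu_q(x)=\lim_{N\to\infty}\frac{1}{[p^N]_q}\sum_{x=0}^{p^N-1}g(x)\,q^x .$$ Let $X=\varprojlim_N\mathbb{Z}/dp^N\mathbb{Z}$. For a function $g$ on $X$, $$\int_X g(x)\,d\mu_q(x)=\lim_{N\to\infty}\frac{1}{[dp^N]_q}\sum_{x=0}^{dp^N-1}g(x)\,q^x ,$$ where in $\chi(x)x^n$ the integers $0\le x<dp^N$ are used in the evident way. The $q$-Bernoulli numbers $B_{n,q}\in\mathbb{C}_p$ and the generalized $q$-Bernoulli numbers $B_{n,q,\chi}\in\mathbb{C}_p$ attached to $\chi$ are defined by the formal power series identities in $\mathbb{C}_p[[t]]$ $$\frac{\log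 q+t}{qe^t-1}=\sum_{n=0}^{\infty}B_{n,q}\frac{t^n}{n!},\qquad \frac{\sum_{a=0}^{d-1}\left(\chi(a)e^{ta}q^a\,t+\chi(a)q^a e^{ta}\log q\right)}{q^de^{dt}-1}=\sum_{n=0}^{\infty}B_{n,q,\chi}\frac{t^n}{n!}.$$ *)

(* Defs.v *)
From HB Require Import structures.
From mathcomp Require Import all_boot all_order all_algebra.
From mathcomp Require Import all_classical all_reals all_analysis.

Set Implicit Arguments.
Unset Strict Implicit.
Unset Printing Implicit Defensive.

Import Order.TTheory GRing.Theory Num.Theory.
Import numFieldNormedType.Exports.
Local Open Scope classical_set_scope.
Local Open Scope ring_scope.

(** * Absolute values, limits and completions *)

Record abs_value (R : realType) (K : fieldType) (v : K -> R) : Prop := {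
  abs_value_ge0 : forall x, 0 <= v x;
  abs_value_eq0 : forall x, (v x == 0) = (x == 0);
  abs_valueM : forall x y, v (x * y) = v x * v y;
  abs_valueD : forall x y, v (x + y) <= Num.max (v x) (v y) }.

Definition abs_cvg (R : realType) (K : fieldType) (v : K -> R)
    (u : nat -> K) (l : K) : Prop :=
  (fun N => v (u N - l)) @ \oo --> (0 : R).

Definition abs_cauchy (R : realType) (K : fieldType) (v : K -> R)
    (u : nat -> K) : Prop :=
  forall e : R, 0 < e ->
    exists N : nat, forall m n, (N <= m)%N -> (N <= n)%N -> v (u m - u n) < e.

(* The limit of [u], with junk value [0] when [u] diverges. *)
Definition abs_lim (R : realType) (K : fieldType) (v : K -> R)
    (u : nat -> K) : K := xget 0 [set l | abs_cvg v u l].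

Record is_completion (R : realType) (F K : fieldType)
    (vF : F -> R) (vK : K -> R) (i : F -> K) : Prop := {
  completion_abs : abs_value vK;
  completion_isometry : forall x, vK (i x) = vF x;
  completion_dense : forall (y : K) (e : R),
    0 < e -> exists x, vK (y - i x) < e;
  completion_complete : forall u,
    abs_cauchy vK u -> exists l, abs_cvg vK u l }.

(** * The field of p-adic complex numbers *)

Definition padic_abs (R : realType) (p : nat) (x : rat) : R :=
  if x == 0 then 0
  else p%:R ^ ((logn p `|denq x|%N)%:Z - (logn p `|numq x|%N)%:Z).

(* The completion of an algebraic closure of the completion of [rat] for
   [padic_abs p].  These fields are unique up to isometric isomorphism, so
   results are stated for an arbitrary such tower. *)
Record padic_complex (R : realType) (p : nat) := PadicComplex {
  Qp : fieldType;
  Qp_abs : Qp -> R;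
  Qp_of_rat : {rmorphism rat -> Qp};
  Qp_completion : is_completion (@padic_abs R p) Qp_abs Qp_of_rat;
  Qpbar : closedFieldType;
  Qpbar_abs : Qpbar -> R;
  Qpbar_of_Qp : {rmorphism Qp -> Qpbar};
  Qpbar_algebraic : forall x : Qpbar, algebraicOver Qpbar_of_Qp x;
  Qpbar_abs_value : abs_value Qpbar_abs;
  Qpbar_abs_ext : forall x : Qp, Qpbar_abs (Qpbar_of_Qp x) = Qp_abs x;
  Cp :> fieldType;
  Cp_abs : Cp -> R;
  Cp_of_Qpbar : {rmorphism Qpbar -> Cp};
  Cp_completion : is_completion Qpbar_abs Cp_abs Cp_of_Qpbar }.

Definition Cp_of_Qp (R : realType) (p : nat) (C : padic_complex R p)
    (x : Qp C) : C := Cp_of_Qpbar C (Qpbar_of_Qp C x).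

(* Only meaningful on the disc |q - 1| < 1, where the series converges. *)
Definition padic_log (R : realType) (p : nat) (C : padic_complex R p)
    (q : C) : C :=
  abs_lim (@Cp_abs R p C)
    (fun N => \sum_(1 <= m < N) (-1) ^+ m.+1 * (q - 1) ^+ m / m%:R).

(** * The p-adic q-integrals *)

Definition qnum (K : fieldType) (q : K) (x : nat) : K :=
  (1 - q ^+ x) / (1 - q).

Definition padic_int (R : realType) (p : nat)
    (C : padic_complex R p) : Type := {x : Qp C | Qp_abs x <= 1}.

Lemma Qp_abs_nat (R : realType) (p : nat) (C : padic_complex R p) (m : nat) :
  Qp_abs (m%:R : Qp C) <= 1.
Proof.
rewrite -(rmorph_nat (Qp_of_rat C)) (completion_isometry (Qp_completion C)).
rewrite /padic_abs; case: eqP => // _; rewrite -[m%:R]/(m%:~R) denq_int numq_int.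
rewrite absz1 logn1 sub0r absz_nat -invr_expz -exprnP.
have [->|p0] := posnP p; first by rewrite lognE /= expr0 invr1.
by rewrite invf_le1 ?exprn_gt0 ?ltr0n// exprn_ege1// ler1n.
Qed.

Definition padic_int_nat (R : realType) (p : nat) (C : padic_complex R p)
    (m : nat) : padic_int C :=
  exist _ (m%:R : Qp C) (Qp_abs_nat C m).

Definition padic_int_val (R : realType) (p : nat) (C : padic_complex R p)
    (x : padic_int C) : C := Cp_of_Qp (sval x).

(* An element of the inverse limit of the rings Z/dp^N, each class being given
   by its representative in {0, ..., dp^N - 1}. *)
Record Xdp (d p : nat) := MkXdp {
  Xdp_res : nat -> nat;
  Xdp_compat : forall N, (Xdp_res N.+1 %% (d * p ^ N) = Xdp_res N)%N }.

Lemma Xdp_nat_compat (d p m N : nat) :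
  (m %% (d * p ^ N.+1) %% (d * p ^ N) = m %% (d * p ^ N))%N.
Proof. by rewrite modn_dvdm// expnSr mulnA dvdn_mulr. Qed.

Definition Xdp_nat (d p m : nat) : Xdp d p :=
  MkXdp (Xdp_nat_compat d p m).

(* The natural projection of X onto Z_p, read in C_p. *)
Definition Xdp_val (R : realType) (p : nat) (C : padic_complex R p) (d : nat)
    (x : Xdp d p) : C :=
  abs_lim (@Cp_abs R p C) (fun N => (Xdp_res x N)%:R).

(* The component of [x] at N = 0 is its class modulo d. *)
Definition Xdp_chi (K : fieldType) (d p : nat) (chi : nat -> K)
    (x : Xdp d p) : K := chi (Xdp_res x 0).

(* "The integral of g over Z_p (resp. X) against mu_q exists and equals I." *)
Definition is_Zp_integral (R : realType) (p : nat) (C : padic_complex R p)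
    (q : C) (g : padic_int C -> C) (I : C) : Prop :=
  abs_cvg (@Cp_abs R p C)
    (fun N => (qnum q (p ^ N))^-1 *
       \sum_(0 <= x < p ^ N) g (padic_int_nat C x) * q ^+ x)
    I.

Definition is_X_integral (R : realType) (p : nat) (C : padic_complex R p)
    (d : nat) (q : C) (g : Xdp d p -> C) (I : C) : Prop :=
  abs_cvg (@Cp_abs R p C)
    (fun N => (qnum q (d * p ^ N))^-1 *
       \sum_(0 <= x < d * p ^ N) g (Xdp_nat d p x) * q ^+ x)
    I.

(** * Dirichlet characters *)

(* Characters are extended by zero to integers not prime to the modulus. *)
Record dirichlet_character (K : fieldType) (d : nat) (chi : nat -> K) : Prop := {
  dirichlet_periodic : forall a, chi (a + d)%N = chi a;
  dirichlet1 : chi 1%N = 1;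
  dirichletM : forall a b, chi (a * b)%N = chi a * chi b;
  dirichlet_neq0 : forall a, (chi a != 0) = coprime a d }.

(* [chi], a character modulo [d], factors through the units modulo [m]. *)
Definition factors_modulo (K : fieldType) (d : nat) (chi : nat -> K)
    (m : nat) : Prop :=
  (m %| d)%N /\ forall a b, coprime a d -> coprime b d ->
    a = b %[mod m] -> chi a = chi b.

Definition is_conductor (K : fieldType) (d : nat) (chi : nat -> K)
    (f : nat) : Prop :=
  factors_modulo d chi f /\ forall m, factors_modulo d chi m -> (f <= m)%N.

(** * Formal power series *)

Definition fps (K : fieldType) : Type := nat -> K.

Section FpsRing.
Variable K : fieldType.
Implicit Types a b c : fps K.

HB.instance Definition _ := gen_eqMixin (fps K).
HB.instance Definition _ := gen_choiceMixin (fps K).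

Definition fps_zero : fps K := fun=> 0.
Definition fps_opp a : fps K := fun n => - a n.
Definition fps_add a b : fps K := fun n => a n + b n.
Definition fps_const (c : K) : fps K := fun n => if n == 0%N then c else 0.
Definition fps_mul a b : fps K := fun n => \sum_(i < n.+1) a i * b (n - i)%N.

Fact fps_addA : associative fps_add.
Proof. by move=> a b c; apply/funext => n; exact: addrA. Qed.
Fact fps_addC : commutative fps_add.
Proof. by move=> a b; apply/funext => n; exact: addrC. Qed.
Fact fps_add0 : left_id fps_zero fps_add.
Proof. by move=> a; apply/funext => n; exact: add0r. Qed.
Fact fps_addN : left_inverse fps_zero fps_opp fps_add.
Proof. by move=> a; apply/funext => n; exact: addNr. Qed.
HB.instance Definition _ :=
  GRing.isZmodule.Build (fps K) fps_addA fps_addC fps_add0 fps_addN.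

Let trunc N a : {poly K} := \poly_(i < N) a i.

Fact fps_mul_trunc N a b n : (n < N)%N ->
  fps_mul a b n = (trunc N a * trunc N b)`_n.
Proof.
move=> nN; rewrite coefM; apply: eq_bigr => i _; rewrite !coef_poly.
by rewrite (leq_ltn_trans _ nN) ?leq_ord// (leq_ltn_trans _ nN) ?leq_subr.
Qed.

Fact fps_mulC : commutative fps_mul.
Proof. by move=> a b; apply/funext => n; rewrite !(@fps_mul_trunc n.+1)// mulrC. Qed.

Fact fps_mulA : associative fps_mul.
Proof.
move=> a b c; apply/funext => n.
have truncM x y i : (i < n.+1)%N ->
    (trunc n.+1 (fps_mul x y))`_i = (trunc n.+1 x * trunc n.+1 y)`_i.
  by move=> iN; rewrite coef_poly iN (@fps_mul_trunc n.+1).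
rewrite !(@fps_mul_trunc n.+1)//.
transitivity ((trunc n.+1 a * (trunc n.+1 b * trunc n.+1 c))`_n).
  by rewrite !coefM; apply: eq_bigr => i _; rewrite truncM// ltnS leq_subr.
by rewrite mulrA !coefM; apply: eq_bigr => i _; rewrite truncM.
Qed.

Fact fps_mul1 : left_id (fps_const 1) fps_mul.
Proof.
move=> a; apply/funext => n; rewrite /fps_mul big_ord_recl /= subn0 mul1r.
by rewrite big1 ?addr0// => i _; rewrite mul0r.
Qed.

Fact fps_mulDl : left_distributive fps_mul fps_add.
Proof.
move=> a b c; apply/funext => n; rewrite /fps_add /fps_mul -big_split /=.
by apply: eq_bigr => i _; rewrite mulrDl.
Qed.

Fact fps_1_neq0 : fps_const 1 != 0 :> fps K.
Proof.
by apply/eqP => /(congr1 (fun a : fps K => a 0%N)) /eqP; rewrite (negbTE (oner_neq0 K)).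
Qed.

HB.instance Definition _ := GRing.Zmodule_isComNzRing.Build (fps K)
  fps_mulA fps_mulC fps_mul1 fps_mulDl fps_1_neq0.

(* The list of the first [n] coefficients of the inverse. *)
Fixpoint fps_inv_seq a (n : nat) : seq K :=
  if n is m.+1 then
    let s := fps_inv_seq a m in
    rcons s ((a 0%N)^-1 *
      (if m == 0%N then 1 else - \sum_(i < m) a (m - i)%N * s`_i))
  else [::].

Definition fps_unit a : bool := a 0%N != 0.

(* As usual in unit rings, a non-invertible series is its own inverse. *)
Definition fps_inv a : fps K :=
  if fps_unit a then fun n => (fps_inv_seq a n.+1)`_n else a.

Fact fps_mulV a : fps_unit a -> fps_mul (fps_inv a) a = 1.
Proof.
move=> ua; rewrite /fps_inv ua; apply/funext => n.
have sz m : size (fps_inv_seq a m) = m by elim: m => //= m IH; rewrite size_rcons IH.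
have nthS m k i : (i < m)%N -> (fps_inv_seq a (m + k))`_i = (fps_inv_seq a m)`_i.
  move=> im; elim: k => [|k IH]; first by rewrite addn0.
  by rewrite addnS /= nth_rcons sz ltn_addr.
rewrite /fps_mul big_ord_recr /= subnn nth_rcons sz ltnn eqxx.
rewrite mulrC mulrA divff// mul1r.
have -> : \sum_(i < n) (fps_inv_seq a i.+1)`_i * a (n - i)%N
        = \sum_(i < n) a (n - i)%N * (fps_inv_seq a n)`_i.
  by apply: eq_bigr => i _; rewrite mulrC -(nthS i.+1 (n - i.+1)%N)// subnKC.
case: n => [|n]; first by rewrite big_ord0 add0r.
by rewrite subrr.
Qed.

Fact fps_mulVr : {in fps_unit, left_inverse 1 fps_inv *%R}.
Proof. by move=> a; exact: fps_mulV. Qed.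

Fact fps_unitP a b : b * a = 1 -> fps_unit a.
Proof.
move=> /(congr1 (fun c : fps K => c 0%N)).
rewrite /GRing.mul /= /fps_mul big_ord1 /= => ba1.
by apply/eqP => a0; move/eqP: ba1; rewrite a0 mulr0 eq_sym (negbTE (oner_neq0 K)).
Qed.

Fact fps_inv_out : {in [predC fps_unit], fps_inv =1 id}.
Proof. by move=> a ua; rewrite /fps_inv (negbTE (ua : ~~ fps_unit a)). Qed.

HB.instance Definition _ := GRing.ComNzRing_hasMulInverse.Build (fps K)
  fps_mulVr fps_unitP fps_inv_out.

Definition fps_t : fps K := fun n => if n == 1%N then 1 else 0.

(* The exponential series e^(ct). *)
Definition fps_exp (c : K) : fps K := fun n => c ^+ n / n`!%:R.

End FpsRing.

(** * q-Bernoulli numbers *)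

Definition qBernoulli_gf (R : realType) (p : nat) (C : padic_complex R p)
    (q : C) : fps C :=
  (fps_const (padic_log q) + fps_t C) / (fps_const q * fps_exp 1 - 1).

Definition qBernoulli (R : realType) (p : nat) (C : padic_complex R p)
    (q : C) (n : nat) : C := n`!%:R * qBernoulli_gf q n.

Definition qBernoulli_chi_gf (R : realType) (p : nat) (C : padic_complex R p)
    (d : nat) (chi : nat -> C) (q : C) : fps C :=
  (\sum_(0 <= a < d)
     (fps_const (chi a) * fps_exp a%:R * fps_const (q ^+ a) * fps_t C
      + fps_const (chi a) * fps_const (q ^+ a) * fps_exp a%:R
        * fps_const (padic_log q)))
  / (fps_const (q ^+ d) * fps_exp d%:R - 1).

Definition qBernoulli_chi (R : realType) (p : nat) (C : padic_complex R p)
    (d : nat) (chi : nat -> C) (q : C) (n : nat) : C :=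
  n`!%:R * qBernoulli_chi_gf d chi q n.

(* Main.v *)
(** On the level of formal power series, [\sum_(x < d p^N) f x q^x e^(xt)] is a
    geometric sum: with [Q = q e^t] and [f] of period [d] it equals
    [(\sum_(a < d) f a Q^a) / (Q^d - 1) * (Q^(d p^N) - 1)].
    Since [(q^(d p^N) - 1) / (d p^N)] tends to [log q], the coefficients of
    [(Q^(d p^N) - 1) / [d p^N]_q] tend to those of [(q - 1) / log q * (log q + t)],
    and [n!] times that of [t^n] gives the integral.  The integral over Z_p is the
    case [d = 1], [f = 1]. *)
Require Import Defs.
From mathcomp Require Import all_boot all_order all_algebra.
From mathcomp Require Import all_classical all_reals all_analysis.
From mathcomp Require Import ring lra.
Import Order.TTheory GRing.Theory Num.Theory.
Local Open Scope ring_scope.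

(** * Limits with respect to an ultrametric absolute value *)

Section AbsValue.
Import numFieldNormedType.Exports.
Local Open Scope classical_set_scope.
Context {R : realType} {K : fieldType} {v : K -> R} (hv : abs_value v).
Implicit Types (x y l : K) (u : nat -> K).

Lemma abs_value0 : v 0 = 0.
Proof. by apply/eqP; rewrite (abs_value_eq0 hv). Qed.

Lemma abs_value1 : v 1 = 1.
Proof.
have v1 : v 1 != 0 by rewrite (abs_value_eq0 hv) oner_neq0.
by apply: (mulfI v1); rewrite -(abs_valueM hv) !mulr1.
Qed.

Lemma abs_valueN x : v (- x) = v x.
Proof.
suff vN1 : v (-1) = 1 by rewrite -mulN1r (abs_valueM hv) vN1 mul1r.
apply/eqP; rewrite -(@eqrXn2 _ 2) ?(abs_value_ge0 hv)//.
by rewrite expr2 -(abs_valueM hv) mulrNN mulr1 abs_value1 expr1n.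
Qed.

Lemma abs_valueX x n : v (x ^+ n) = v x ^+ n.
Proof.
elim: n => [|n IH]; first by rewrite !expr0 abs_value1.
by rewrite !exprS (abs_valueM hv) IH.
Qed.

Lemma abs_valueV x : v x^-1 = (v x)^-1.
Proof.
have [->|x0] := eqVneq x 0; first by rewrite invr0 abs_value0 invr0.
have vx0 : v x != 0 by rewrite (abs_value_eq0 hv).
by apply: (mulfI vx0); rewrite -(abs_valueM hv) !divff// abs_value1.
Qed.

Lemma abs_valueD_le x y : v (x + y) <= v x + v y.
Proof.
apply: (le_trans (abs_valueD hv x y)).
by rewrite ge_max lerDl lerDr !(abs_value_ge0 hv).
Qed.

Lemma abs_valueD_bound x y b : v x <= b -> v y <= b -> v (x + y) <= b.
Proof.
by move=> xb yb; apply: (le_trans (abs_valueD hv x y)); rewrite ge_max xb yb.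
Qed.

Lemma abs_value_sum_bound (I : Type) (s : seq I) (P : pred I) (F : I -> K) b :
  0 <= b -> (forall i, P i -> v (F i) <= b) -> v (\sum_(i <- s | P i) F i) <= b.
Proof.
move=> b0 Fb; elim/big_rec: _ => [|i y Pi yb]; first by rewrite abs_value0.
exact: abs_valueD_bound (Fb i Pi) yb.
Qed.

Lemma abs_value_nat_le1 n : v n%:R <= 1.
Proof.
elim: n => [|n IH]; first by rewrite abs_value0.
by rewrite -natr1; apply: abs_valueD_bound => //; rewrite abs_value1.
Qed.

Lemma abs_value_dist x y : `|v x - v y| <= v (x - y).
Proof.
rewrite ler_norml -[v (x - y)]abs_valueN opprB.
have := abs_valueD_le (x - y) y; have := abs_valueD_le (y - x) x.
rewrite !subrK -[v (x - y)]abs_valueN opprB => h1 h2.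
by apply/andP; split; lra.
Qed.

Lemma abs_cvg_squeeze u l (e : nat -> R) :
  (forall N, v (u N - l) <= e N) -> e @ \oo --> (0 : R) -> abs_cvg v u l.
Proof.
move=> ue e0; apply: (squeeze_cvgr _ (cvg_cst 0) e0).
by near=> N; rewrite ue (abs_value_ge0 hv).
Unshelve. all: by end_near. Qed.

Lemma abs_cvg_cst l : abs_cvg v (fun=> l) l.
Proof.
by apply: (@abs_cvg_squeeze _ _ (fun=> 0)) => [N|];
  [rewrite subrr abs_value0 | exact: cvg_cst].
Qed.

Lemma abs_cvg_near u u' l :
  (\forall N \near \oo, u N = u' N) -> abs_cvg v u l -> abs_cvg v u' l.
Proof.
move=> uu'; rewrite /abs_cvg => h; apply: cvg_trans h.
by apply: near_eq_cvg; apply: filterS uu' => N ->.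
Qed.

Lemma abs_cvgD u u' l l' : abs_cvg v u l -> abs_cvg v u' l' ->
  abs_cvg v (fun N => u N + u' N) (l + l').
Proof.
move=> ul u'l'.
apply: (@abs_cvg_squeeze _ _ (fun N => v (u N - l) + v (u' N - l'))).
  by move=> N; rewrite opprD addrACA abs_valueD_le.
by rewrite -(addr0 0); exact: cvgD.
Qed.

Lemma abs_cvg_sum m (u : nat -> nat -> K) (l : nat -> K) :
  (forall i, abs_cvg v (u i) (l i)) ->
  abs_cvg v (fun N => \sum_(i < m) u i N) (\sum_(i < m) l i).
Proof.
move=> ul; elim: m => [|m IH].
  by rewrite big_ord0; under eq_fun do rewrite big_ord0; exact: abs_cvg_cst.
by rewrite big_ord_recr; under eq_fun do rewrite big_ord_recr; exact: abs_cvgD.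
Qed.

Lemma abs_cvgM u u' l l' : abs_cvg v u l -> abs_cvg v u' l' ->
  abs_cvg v (fun N => u N * u' N) (l * l').
Proof.
move=> ul u'l'.
apply: (@abs_cvg_squeeze _ _ (fun N => v (u N - l) * v (u' N - l')
  + (v (u N - l) * v l' + v l * v (u' N - l')))).
  move=> N; rewrite -!(abs_valueM hv).
  have -> : u N * u' N - l * l' = (u N - l) * (u' N - l')
      + ((u N - l) * l' + l * (u' N - l')) by ring.
  apply: (le_trans (abs_valueD_le _ _)); rewrite lerD2l.
  exact: abs_valueD_le.
have -> : (0 : R) = 0 * 0 + (0 * v l' + v l * 0) by rewrite !mul0r mulr0 !addr0.
apply: cvgD; first exact: cvgM.
by apply: cvgD; apply: cvgM => //; exact: cvg_cst.
Qed.

Lemma abs_cvgX u l n : abs_cvg v u l -> abs_cvg v (fun N => u N ^+ n) (l ^+ n).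
Proof.
move=> ul; elim: n => [|n IH]; first exact: abs_cvg_cst.
by rewrite exprS; under eq_fun do rewrite exprS; exact: abs_cvgM.
Qed.

Lemma abs_cvg_abs u l : abs_cvg v u l -> (fun N => v (u N)) @ \oo --> v l.
Proof.
move=> /(@cvgrPdist_le _ R) ul; apply/cvgrPdist_le => e e0.
apply: filterS (ul e e0) => N.
rewrite sub0r normrN ger0_norm ?(abs_value_ge0 hv)// => h.
by rewrite distrC (le_trans (abs_value_dist _ _)).
Qed.

Lemma abs_cvgV u l : l != 0 -> (forall N, u N != 0) ->
  abs_cvg v u l -> abs_cvg v (fun N => (u N)^-1) l^-1.
Proof.
move=> l0 u0 ul.
apply: (@abs_cvg_squeeze _ _ (fun N => v (u N - l) * ((v (u N))^-1 * (v l)^-1))).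
  move=> N; rewrite -!abs_valueV -!(abs_valueM hv) -abs_valueN.
  rewrite (_ : - _ = (u N - l) / u N / l) ?mulrA//.
  by field; rewrite u0 l0.
rewrite -(mul0r ((v l)^-1 * (v l)^-1)); apply: cvgM => //; apply: cvgM.
  by apply: cvgV; [rewrite (abs_value_eq0 hv)|exact: abs_cvg_abs].
exact: cvg_cst.
Qed.

Lemma abs_cvg_unique u l l' : abs_cvg v u l -> abs_cvg v u l' -> l = l'.
Proof.
move=> ul ul'; apply/eqP; rewrite -subr_eq0 -(abs_value_eq0 hv); apply/eqP.
(* The sequence [u N + (-1) * u N] is identically 0 and tends to [l - l']; uniqueness of real limits
   then gives [v (l - l') = 0]. *)
have := abs_cvgD _ _ _ _ ul (abs_cvgM _ _ _ _ (abs_cvg_cst (-1)) ul').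
under eq_fun do rewrite mulN1r subrr.
rewrite mulN1r => /abs_cvg_abs; rewrite abs_value0 => h.
exact: (cvg_unique _ h (cvg_cst 0)).
Qed.

Lemma abs_lim_cvg u l : abs_cvg v u l -> abs_cvg v u (abs_lim v u).
Proof. by move=> ul; rewrite /abs_lim; case: xgetP => [x ->//|/(_ l)]. Qed.

Lemma abs_limE u l : abs_cvg v u l -> abs_lim v u = l.
Proof. by move=> ul; exact: (abs_cvg_unique _ _ _ (abs_lim_cvg _ _ ul) ul). Qed.

End AbsValue.

(** Each [r ^+ i] with [i < m] is at least [r ^+ m], so the left side is at most a partial geometric
    sum. The bound absorbs linear factors [m] in the estimates for the logarithm. *)
Lemma mul_expr_le (R : realType) (r : R) m : 0 <= r -> r < 1 ->
  m%:R * r ^+ m <= (1 - r)^-1.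
Proof.
move=> r0 r1; have r1' : 0 < 1 - r by rewrite subr_gt0.
rewrite -[_^-1]mul1r ler_pdivlMr//.
apply: (@le_trans _ _ ((\sum_(i < m) r ^+ i) * (1 - r))).
  rewrite ler_wpM2r ?(ltW r1')//.
  have -> : m%:R * r ^+ m = \sum_(i < m) r ^+ m.
    by rewrite sumr_const card_ord mulr_natl.
  by apply: ler_sum => i _; rewrite ler_wiXn2l ?(ltW r1) ?(ltnW (ltn_ord i)).
by rewrite mulrC -[1 - r]opprB mulNr -subrX1 opprB lerBlDr lerDl exprn_ge0.
Qed.

(** * Integers and binomial coefficients in C_p *)

Section Cp.
Import numFieldNormedType.Exports.
Local Open Scope classical_set_scope.
Context {R : realType} {p : nat} {C : padic_complex R p} (p_prime : prime p).
Local Notation v := (@Cp_abs R p C).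
Let hv : abs_value v := completion_abs (Cp_completion C).

(** The embeddings of the tower are isometric, which reduces the value to [padic_abs] on an integer
    of denominator 1. *)
Lemma Cp_abs_nat m : (0 < m)%N -> v m%:R = p%:R ^- logn p m.
Proof.
move=> m0; rewrite -(rmorph_nat (Cp_of_Qpbar C)).
rewrite (completion_isometry (Cp_completion C)) -(rmorph_nat (Qpbar_of_Qp C)).
rewrite Qpbar_abs_ext -(rmorph_nat (Qp_of_rat C)).
rewrite (completion_isometry (Qp_completion C)) /padic_abs.
rewrite pnatr_eq0 gtn_eqF// -[m%:R]/(m%:~R) denq_int numq_int.
by rewrite absz1 logn1 sub0r absz_nat -invr_expz.
Qed.

Lemma Cp_nat_neq0 m : (0 < m)%N -> m%:R != 0 :> C.
Proof.
move=> m0; rewrite -(abs_value_eq0 hv) (Cp_abs_nat _ m0).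
by rewrite invr_eq0 expf_neq0// pnatr_eq0 -lt0n prime_gt0.
Qed.

(** The left side is the exact power of p dividing [m], hence at most [m]. This crude bound controls
    all denominators below. *)
Lemma Cp_abs_natV_le m : (0 < m)%N -> v m%:R^-1 <= m%:R.
Proof.
move=> m0; rewrite (abs_valueV hv) (Cp_abs_nat _ m0) invrK -natrX ler_nat.
exact: dvdn_leq (pfactor_dvdnn p m).
Qed.

Lemma Cp_bin_diag n k : 'C(n, k.+1)%:R = n%:R * 'C(n.-1, k)%:R / k.+1%:R :> C.
Proof.
by rewrite -natrM mul_bin_diag natrM mulrAC divff ?mul1r ?Cp_nat_neq0.
Qed.

Lemma Cp_abs_pexp N : v (p ^ N)%:R = p%:R^-1 ^+ N.
Proof. by rewrite Cp_abs_nat ?expn_gt0 ?prime_gt0// pfactorK// exprVn. Qed.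

Lemma pexp_cvg0 : abs_cvg v (fun N => (p ^ N)%:R) 0.
Proof.
apply: (abs_cvg_squeeze hv _ _ (fun N => p%:R^-1 ^+ N)).
  by move=> N; rewrite subr0 Cp_abs_pexp.
apply: cvg_expr; rewrite ger0_norm ?invr_ge0// invf_lt1 ?ltr0n ?ltr1n//.
  exact: prime_gt1.
exact: prime_gt0.
Qed.

(** Induction by Pascal's rule: the discrepancy at [k.+1] is ['C(p ^ N, k.+1)] minus the discrepancy
    at [k]. That binomial coefficient is [p ^ N] times an integer divided by [k.+1], so its absolute
    value is at most [p^-N * k.+1], and the ultrametric inequality takes a maximum instead of a
    sum. *)
Lemma Cp_abs_bin_pexp N k :
  v ('C((p ^ N).-1, k)%:R - (-1) ^+ k) <= p%:R^-1 ^+ N * k%:R.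
Proof.
have pN0 : (0 < p ^ N)%N by rewrite expn_gt0 prime_gt0.
have pN0' : 0 <= p%:R^-1 ^+ N :> R by rewrite exprn_ge0// invr_ge0.
elim: k => [|k IH]; first by rewrite bin0 subrr (abs_value0 hv) mulr0.
have -> : 'C((p ^ N).-1, k.+1)%:R - (-1) ^+ k.+1
    = 'C(p ^ N, k.+1)%:R - ('C((p ^ N).-1, k)%:R - (-1) ^+ k) :> C.
  by rewrite -[in RHS](prednK pN0) binS natrD exprS; ring.
apply: (abs_valueD_bound hv); last first.
  by rewrite (abs_valueN hv) (le_trans IH)// ler_wpM2l// ler_nat.
rewrite Cp_bin_diag !(abs_valueM hv) Cp_abs_pexp ler_pM// ?mulr_ge0 ?(abs_value_ge0 hv)//.
  by rewrite ler_piMr// (abs_value_nat_le1 hv).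
exact: Cp_abs_natV_le.
Qed.

(** * The p-adic logarithm as a limit of powers *)

Section Log.
Context {q : C} (q_near1 : v (q - 1) < 1).
(** The square root splits [|q-1|^m] into two factors [s ^+ m]: one pays for a factor [m] through
    [mul_expr_le], and the other remains, either for geometric decay or to pay for a second [m]. *)
Local Notation s := (Num.sqrt (v (q - 1))).
Local Notation log_sum :=
  (fun N => \sum_(1 <= m < N) (-1) ^+ m.+1 * (q - 1) ^+ m / m%:R : C).

Let s_lt1 : s < 1.
Proof. by rewrite -sqrtr1 ltr_sqrt. Qed.

Let s1V_ge0 : 0 <= (1 - s)^-1.
Proof. by rewrite invr_ge0 subr_ge0 ltW. Qed.

Let mul_abs_exp m : m%:R * v (q - 1) ^+ m = m%:R * s ^+ m * s ^+ m.
Proof.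
by rewrite -mulrA -exprMn -expr2 sqr_sqrtr ?(abs_value_ge0 hv).
Qed.

Lemma Cp_abs_log_term m : (0 < m)%N ->
  v ((-1) ^+ m.+1 * (q - 1) ^+ m / m%:R) <= (1 - s)^-1 * s ^+ m.
Proof.
move=> m0; rewrite !(abs_valueM hv) !(abs_valueX hv) (abs_valueN hv).
rewrite (abs_value1 hv) expr1n mul1r.
apply: (@le_trans _ _ (m%:R * v (q - 1) ^+ m)).
  rewrite mulrC ler_wpM2r ?exprn_ge0 ?(abs_value_ge0 hv)//.
  exact: Cp_abs_natV_le.
by rewrite mul_abs_exp ler_wpM2r ?exprn_ge0 ?mul_expr_le.
Qed.

Lemma log_sum_cvg : abs_cvg v log_sum (padic_log q).
Proof.
(* [padic_log] is the limit selected by [abs_lim], so the existence of some limit is enough;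
   completeness reduces this to the Cauchy property. *)
suff [l ul] : exists l, abs_cvg v log_sum l by exact: abs_lim_cvg ul.
apply: (completion_complete (Cp_completion C)) => e e0.
have : (fun N => (1 - s)^-1 * s ^+ N) @ \oo --> (0 : R).
  by apply: cvg_geometric; rewrite ger0_norm.
move=> /cvgr0Pnorm_lt /(_ e e0) [M _ hM].
exists M.+1 => m n.
wlog mn : m n / (m <= n)%N => [W Mm Mn|Mm Mn].
  have [mn|/ltnW nm] := leqP m n; first exact: W.
  by rewrite -(abs_valueN hv) opprB; exact: W.
have m0 : (0 < m)%N by exact: leq_trans Mm.
(* The difference of the partial sums is the block of terms from [m] to [n.-1], and the ultrametric
   inequality bounds it by the bound for its first term. *)
rewrite -(abs_valueN hv) opprB (big_cat_nat m0 mn) /= addrAC subrr add0r.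
apply: le_lt_trans (hM m (ltnW Mm)).
rewrite ger0_norm ?mulr_ge0 ?exprn_ge0//.
rewrite big_nat_cond; apply: (abs_value_sum_bound hv) => [|i].
  by rewrite mulr_ge0 ?exprn_ge0.
rewrite andbT => /andP[mi _].
apply: (le_trans (Cp_abs_log_term _ (leq_trans m0 mi))).
by rewrite ler_wpM2l// ler_wiXn2l// ltW.
Qed.

(** Expand [(1 + (q - 1)) ^+ (p ^ N)]: the constant term cancels, and [Cp_bin_diag] extracts the
    factor [p ^ N] from every other binomial coefficient. *)
Lemma expr_pexp_sub1 N : (q ^+ (p ^ N) - 1) / (p ^ N)%:R
  = \sum_(1 <= m < (p ^ N).+1) 'C((p ^ N).-1, m.-1)%:R * (q - 1) ^+ m / m%:R.
Proof.
have pN0 : (0 < p ^ N)%N by rewrite expn_gt0 prime_gt0.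
rewrite big_add1 big_mkord -[in LHS](subrK 1 q) exprD1n big_ord_recl.
rewrite expr0 bin0 mulr1n addrAC subrr add0r mulr_suml.
apply: eq_bigr => m _; rewrite lift0 /= -mulr_natr.
rewrite Cp_bin_diag.
have := Cp_nat_neq0 _ pN0; have := Cp_nat_neq0 _ (ltn0Sn m).
by move: (p ^ N)%:R m.+1%:R => a b b0 a0; field; rewrite b0 a0.
Qed.

(* Termwise, replacing [(-1)^(m-1)] by [binomial (p^N - 1) (m - 1)] in the
   series of the logarithm costs at most [p^-N m^2 |q-1|^m], and [m^2 |q-1|^m]
   is bounded. *)
Lemma expr_pexp_cvg_log :
  abs_cvg v (fun N => (q ^+ (p ^ N) - 1) / (p ^ N)%:R) (padic_log q).
Proof.
(* [log_sum] excludes its upper index, so the subsequence at [(p ^ N).+1] has exactly the range of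
   [expr_pexp_sub1]. *)
have pN1 : (fun N => (p ^ N).+1) @ \oo --> \oo.
  move=> A [M _ MA]; exists M => // N /= MN; apply: MA => /=.
  by rewrite (leq_trans MN)// ltnW// ltnW// ltnS ltn_expl// prime_gt1.
have L := cvg_comp _ _ pN1 log_sum_cvg.
pose e N := \sum_(1 <= m < (p ^ N).+1)
  ('C((p ^ N).-1, m.-1)%:R - (-1) ^+ m.-1) * (q - 1) ^+ m / m%:R : C.
suff e0 : abs_cvg v e 0.
  rewrite -[padic_log q]addr0; apply: abs_cvg_near (abs_cvgD hv _ _ _ _ L e0).
  apply: nearW => N; rewrite expr_pexp_sub1 -big_split /=.
  apply: eq_big_nat => -[|m]// _ /=.
  by rewrite !exprS; ring.
apply: (abs_cvg_squeeze hv _ _ (fun N => p%:R^-1 ^+ N * ((1 - s)^-1 * (1 - s)^-1))).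
  move=> N; have pN0' : 0 <= p%:R^-1 ^+ N :> R by rewrite exprn_ge0// invr_ge0.
  rewrite subr0 /e big_nat_cond; apply: (abs_value_sum_bound hv).
    exact: mulr_ge0 pN0' (mulr_ge0 s1V_ge0 s1V_ge0).
  move=> [|m]// _ /=.
  rewrite !(abs_valueM hv) (abs_valueX hv) -mulrA.
  apply: (@le_trans _ _ ((p%:R^-1 ^+ N * m.+1%:R) * (m.+1%:R * v (q - 1) ^+ m.+1))).
    apply: ler_pM; rewrite ?mulr_ge0 ?exprn_ge0 ?(abs_value_ge0 hv)//.
      by rewrite (le_trans (Cp_abs_bin_pexp _ _))// ler_wpM2l// ler_nat.
    rewrite mulrC ler_wpM2r ?exprn_ge0 ?(abs_value_ge0 hv)//.
    exact: Cp_abs_natV_le.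
  (* One factor [m.+1] comes from the binomial discrepancy and the other from the denominator; each
     is paired with its own [s ^+ m.+1]. *)
  rewrite mul_abs_exp -[leLHS]mulrA ler_wpM2l//.
  rewrite -[X in _ * X]mulrA [leLHS]mulrA mulrACA.
  by apply: ler_pM; rewrite ?mulr_ge0 ?exprn_ge0 ?mul_expr_le.
have -> : (0 : R) = 0 * ((1 - s)^-1 * (1 - s)^-1) by rewrite mul0r.
apply: cvgM; last exact: cvg_cst.
apply: cvg_expr; rewrite ger0_norm ?invr_ge0// invf_lt1 ?ltr0n ?ltr1n//.
  exact: prime_gt1.
exact: prime_gt0.
Qed.

(** Write [q ^+ (p ^ N)] as 1 plus [p ^ N] times the quotient that tends to [padic_log q]; the
    factor [p ^ N] tends to 0. *)
Lemma expr_pexp_cvg1 : abs_cvg v (fun N => q ^+ (p ^ N)) 1.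
Proof.
have := abs_cvgD hv _ _ _ _ (abs_cvg_cst hv 1)
  (abs_cvgM hv _ _ _ _ pexp_cvg0 expr_pexp_cvg_log).
rewrite mul0r addr0; apply: abs_cvg_near; apply: nearW => N.
by rewrite mulrCA divff ?mulr1 ?subrKC// Cp_nat_neq0// expn_gt0 prime_gt0.
Qed.

Context {d : nat} (d_gt0 : (0 < d)%N).

Lemma expr_dpexp_cvg1 : abs_cvg v (fun N => q ^+ (d * p ^ N)) 1.
Proof.
have := abs_cvgX hv _ _ d expr_pexp_cvg1; rewrite expr1n.
by apply: abs_cvg_near; apply: nearW => N; rewrite -exprM mulnC.
Qed.

(** With [y = q ^+ (p ^ N)], factor [y ^+ d - 1] as [y - 1] times the sum of [y ^+ i] over [i < d].
    As [y] tends to 1 this sum tends to [d], which cancels the extra [d] in the denominator. *)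
Lemma expr_dpexp_cvg_log : abs_cvg v
  (fun N => (q ^+ (d * p ^ N) - 1) / (d * p ^ N)%:R) (padic_log q).
Proof.
have S1 := abs_cvg_sum hv d _ _ (fun i => abs_cvgX hv _ _ i expr_pexp_cvg1).
have := abs_cvgM hv _ _ _ _ (abs_cvgM hv _ _ _ _ expr_pexp_cvg_log S1)
  (abs_cvg_cst hv d%:R^-1).
under eq_bigr do rewrite expr1n.
rewrite sumr_const card_ord mulfK ?Cp_nat_neq0//; apply: abs_cvg_near; apply: nearW => N.
rewrite [in RHS]mulnC exprM [in RHS]subrX1 natrM invfM /= -!mulrA.
by congr (_ * _); rewrite mulrCA.
Qed.

(** If the power were 1 at [N], it would be 1 at every later index, and the quotients tending to
    [padic_log q] would eventually vanish. *)
Lemma expr_dpexp_neq1 N : padic_log q != 0 -> q ^+ (d * p ^ N) - 1 != 0.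
Proof.
move=> l0; apply: contra_neq l0 => /eqP; rewrite subr_eq0 => /eqP qN.
apply: (abs_cvg_unique hv _ _ _ expr_dpexp_cvg_log).
apply: abs_cvg_near (abs_cvg_cst hv 0).
exists N => // M /= NM; rewrite -(subnKC NM) expnD mulnA exprM qN expr1n.
by rewrite subrr mul0r.
Qed.

Lemma expr_dpexp_cvgV_log : padic_log q != 0 -> abs_cvg v
  (fun N => (d * p ^ N)%:R / (q ^+ (d * p ^ N) - 1)) (padic_log q)^-1.
Proof.
move=> l0.
have u0 N : (q ^+ (d * p ^ N) - 1) / (d * p ^ N)%:R != 0 :> C.
  rewrite mulf_neq0 ?expr_dpexp_neq1// invr_eq0 Cp_nat_neq0//.
  by rewrite muln_gt0 d_gt0 expn_gt0 prime_gt0.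
apply: abs_cvg_near (abs_cvgV hv _ _ l0 u0 expr_dpexp_cvg_log).
by apply: nearW => N; rewrite invf_div.
Qed.

End Log.
End Cp.

(** * Exponential series and geometric sums of formal power series *)

Section Fps.
Context {K : fieldType}.
Implicit Types (a b : fps K) (c : K).

Lemma fps_addE a b n : (a + b) n = a n + b n.
Proof. by []. Qed.

Lemma fps_subE a b n : (a - b) n = a n - b n.
Proof. by []. Qed.

Lemma fps_mulE a b n : (a * b) n = \sum_(i < n.+1) a i * b (n - i)%N.
Proof. by []. Qed.

Lemma fps_1E n : (1 : fps K) n = (n == 0%N)%:R.
Proof. by case: n. Qed.

Lemma fps_sumE (I : Type) (s : seq I) (F : I -> fps K) n :
  (\sum_(i <- s) F i) n = \sum_(i <- s) F i n.
Proof. by elim/big_rec2: _ => // i x y _ <-. Qed.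

Lemma fps_constM c a n : (fps_const c * a) n = c * a n.
Proof.
rewrite fps_mulE big_ord_recl /= subn0 big1 ?addr0// => i _.
by rewrite mul0r.
Qed.

Lemma fps_const_mul c c' : fps_const c * fps_const c' = fps_const (c * c').
Proof.
by apply/funext => n; rewrite fps_constM /fps_const; case: eqP; rewrite ?mulr0.
Qed.

Lemma fps_constX c n : fps_const c ^+ n = fps_const (c ^+ n).
Proof. by elim: n => // n IH; rewrite !exprS IH fps_const_mul. Qed.

Context (K_char0 : forall n, (0 < n)%N -> n%:R != 0 :> K).

Lemma fps_expD c c' : fps_exp (c + c') = fps_exp c * fps_exp c'.
Proof.
apply/funext => n; rewrite fps_mulE /fps_exp addrC exprDn mulr_suml.
apply: eq_bigr => i _; have le_in : (i <= n)%N by rewrite -ltnS.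
have := bin_fact le_in => /(congr1 (fun m => m%:R : K)).
rewrite !natrM => <-; rewrite -mulr_natr.
have b0 : 'C(n, i)%:R != 0 :> K by rewrite K_char0// bin_gt0.
have f0 m : m`!%:R != 0 :> K by rewrite K_char0// fact_gt0.
by field; rewrite b0 !f0.
Qed.

Lemma fps_exp0 : fps_exp 0 = 1 :> fps K.
Proof.
apply/funext => -[|n]; first by rewrite fps_1E /fps_exp expr0 invr1 mulr1.
by rewrite fps_1E /fps_exp expr0n mul0r.
Qed.

Lemma fps_expX n : fps_exp 1 ^+ n = fps_exp n%:R :> fps K.
Proof.
by elim: n => [|n IH]; rewrite ?fps_exp0// exprS IH -fps_expD -natr1 addrC.
Qed.

Lemma fps_const_expX c n :
  (fps_const c * fps_exp 1) ^+ n = fps_const (c ^+ n) * fps_exp n%:R.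
Proof. by rewrite exprMn fps_constX fps_expX. Qed.

Lemma fps_const_expE c x n : (fps_const c * fps_exp x) n = c * (x ^+ n / n`!%:R).
Proof. by rewrite fps_constM. Qed.

Lemma fps_unitE a : (a \is a GRing.unit) = (a 0%N != 0).
Proof. by []. Qed.

(** Induction on the number [M] of periods: the next block is the first one times [Q ^+ (d * M)],
    and the right side telescopes. The product form avoids division. *)
Lemma periodic_sum (f : nat -> K) (d M : nat) (Q : fps K) :
  (forall x, f (x + d)%N = f x) ->
  (\sum_(0 <= x < d * M) fps_const (f x) * Q ^+ x) * (Q ^+ d - 1)
  = (\sum_(0 <= x < d) fps_const (f x) * Q ^+ x) * (Q ^+ (d * M) - 1).
Proof.
move=> fd; have fdM m x : f (x + d * m)%N = f x.
  by elim: m => [|m IH]; rewrite ?muln0 ?addn0// mulnS addnCA addnC fd.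
elim: M => [|M IH]; first by rewrite muln0 big_nil mul0r subrr mulr0.
rewrite (@big_cat_nat _ _ _ (d * M)) ?leq_mul//= mulrDl IH.
rewrite -{2}[(d * M)%N]add0n big_addn -mulnBr subSnn muln1.
have -> : \sum_(0 <= i < d) fps_const (f (i + d * M)%N) * Q ^+ (i + d * M)
    = (\sum_(0 <= x < d) fps_const (f x) * Q ^+ x) * Q ^+ (d * M).
  by rewrite mulr_suml; apply: eq_bigr => i _; rewrite fdM exprD mulrA.
by rewrite mulnS [Q ^+ (d + _)]exprD; ring.
Qed.

End Fps.

(** * Passage to the limit in the q-integrals *)

Section Integral.
Import numFieldNormedType.Exports.
Context {R : realType} {p : nat} {C : padic_complex R p} (p_prime : prime p).
Context {q : C} (q_near1 : Cp_abs (q - 1) < 1) (log_neq0 : padic_log q != 0).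
Local Notation v := (@Cp_abs R p C).
Let hv : abs_value v := completion_abs (Cp_completion C).
Local Notation Q := (fps_const q * fps_exp 1 : fps C).

Let C_char0 n : (0 < n)%N -> n%:R != 0 :> C.
Proof. exact: Cp_nat_neq0. Qed.

(** With [M = d * p ^ N], the term is [(q - 1) / (q ^+ M - 1)] times [q ^+ M * M ^+ k / k!], less 1
    when [k = 0]. For [k = 0] it is constantly [q - 1]; for [k = 1] the factor [M / (q ^+ M - 1)]
    tends to the inverse logarithm; for [k >= 2] the surplus [M ^+ k.-1] forces the limit 0. *)
Lemma qnum_fps_cvg d k : (0 < d)%N ->
  abs_cvg v (fun N => (qnum q (d * p ^ N))^-1 * (Q ^+ (d * p ^ N) - 1) k)
    ((q - 1) / padic_log q * (fps_const (padic_log q) + fps_t C) k).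
Proof.
move=> d0; have dpN N : q ^+ (d * p ^ N) - 1 != 0 by exact: expr_dpexp_neq1.
have qnumE N : (qnum q (d * p ^ N))^-1 = (q - 1) / (q ^+ (d * p ^ N) - 1).
  by rewrite /qnum invf_div -opprB -[1 - q ^+ _]opprB invrN mulrNN.
have W := expr_dpexp_cvgV_log p_prime q_near1 d0 log_neq0.
have q1 := expr_dpexp_cvg1 p_prime q_near1 (d := d).
case: k => [|[|k]].
- rewrite fps_addE addr0 /= divfK//.
  apply: abs_cvg_near (abs_cvg_cst hv (q - 1)); apply: nearW => N.
  rewrite qnumE fps_const_expX// fps_subE fps_const_expE fps_1E.
  by rewrite expr0 divr1 mulr1 divfK.
- rewrite fps_addE /= add0r mulr1.
  have := abs_cvgM hv _ _ _ _ (abs_cvgM hv _ _ _ _ (abs_cvg_cst hv (q - 1)) W) q1.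
  rewrite mulr1; apply: abs_cvg_near; apply: nearW => N.
  rewrite qnumE fps_const_expX// fps_subE fps_const_expE fps_1E.
  by rewrite expr1 divr1 subr0 -!mulrA; congr (_ * _); rewrite mulrC -mulrA mulrC.
- rewrite fps_addE /= addr0 mulr0.
  have c0 := abs_cvgM hv _ _ _ _ (abs_cvgX hv _ _ k.+1
    (abs_cvgM hv _ _ _ _ (abs_cvg_cst hv d%:R) (pexp_cvg0 p_prime)))
    (abs_cvg_cst hv (k.+2)`!%:R^-1).
  have := abs_cvgM hv _ _ _ _ (abs_cvgM hv _ _ _ _
    (abs_cvgM hv _ _ _ _ (abs_cvg_cst hv (q - 1)) W) q1) c0.
  rewrite mulr0 expr0n mul0r mulr0; apply: abs_cvg_near; apply: nearW => N.
  rewrite qnumE fps_const_expX// fps_subE fps_const_expE fps_1E subr0.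
  by rewrite -natrM [in RHS]exprS; ring.
Qed.

(** The factor [log q + t] comes out of every summand of the numerator, leaving the quotient to
    which [periodic_sum] applies. *)
Lemma qBernoulli_chi_gfE d (f : nat -> C) :
  qBernoulli_chi_gf d f q
  = (\sum_(0 <= a < d) fps_const (f a) * Q ^+ a) / (Q ^+ d - 1)
    * (fps_const (padic_log q) + fps_t C).
Proof.
rewrite /qBernoulli_chi_gf -fps_const_expX// [RHS]mulrAC; congr (_ / _).
by rewrite mulr_suml; apply: eq_bigr => a _; rewrite fps_const_expX//; ring.
Qed.

Lemma periodic_integral_cvg d (f : nat -> C) n : (0 < d)%N ->
  (forall x, f (x + d)%N = f x) ->
  abs_cvg v (fun N => (qnum q (d * p ^ N))^-1 *
      \sum_(0 <= x < d * p ^ N) f x * x%:R ^+ n * q ^+ x)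
    ((q - 1) / padic_log q * qBernoulli_chi d f q n).
Proof.
move=> d0 fd; pose G := (\sum_(0 <= a < d) fps_const (f a) * Q ^+ a) / (Q ^+ d - 1).
(* The constant coefficient is [q ^+ d - 1], which is nonzero by [expr_dpexp_neq1] at [N = 0]; hence
   [d] is rewritten as [d * p ^ 0]. *)
have Gu : Q ^+ d - 1 \is a GRing.unit.
  rewrite fps_unitE fps_const_expX// fps_subE fps_const_expE fps_1E.
  rewrite expr0 divr1 mulr1 -[d]muln1 -(expn0 p).
  exact: expr_dpexp_neq1.
have sumE N : \sum_(0 <= x < d * p ^ N) f x * x%:R ^+ n * q ^+ x
    = n`!%:R * (G * (Q ^+ (d * p ^ N) - 1)) n.
  have -> : G * (Q ^+ (d * p ^ N) - 1)
      = \sum_(0 <= x < d * p ^ N) fps_const (f x) * Q ^+ x.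
    by rewrite mulrAC -periodic_sum// mulrK.
  rewrite fps_sumE mulr_sumr; apply: eq_bigr => x _.
  rewrite fps_const_expX// fps_constM fps_const_expE.
  have n0 : n`!%:R != 0 :> C by rewrite C_char0// fact_gt0.
  by field.
rewrite /qBernoulli_chi qBernoulli_chi_gfE -/G.
(* [G] does not depend on [N], and the coefficient of degree [n] of the product is a sum of [n.+1]
   terms, so the limit may be taken term by term. *)
have := abs_cvgM hv _ _ _ _ (abs_cvg_cst hv n`!%:R) (abs_cvg_sum hv n.+1 _ _
  (fun i => abs_cvgM hv _ _ _ _ (abs_cvg_cst hv (G i))
                                (qnum_fps_cvg d (n - i) d0))).
have -> : n`!%:R * \sum_(i < n.+1) G i *
      ((q - 1) / padic_log q * (fps_const (padic_log q) + fps_t C) (n - i)%N)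
    = (q - 1) / padic_log q *
      (n`!%:R * (G * (fps_const (padic_log q) + fps_t C)) n).
  rewrite fps_mulE mulrCA; congr (_ * _); rewrite mulr_sumr.
  by apply: eq_bigr => i _; rewrite mulrCA.
apply: abs_cvg_near; apply: nearW => N.
rewrite sumE fps_mulE mulrCA; congr (_ * _); rewrite mulr_sumr.
by apply: eq_bigr => i _; rewrite mulrCA.
Qed.

(** The residues of [m] modulo [d * p ^ N] equal [m] as soon as [m <= N], because [N < p ^ N]. *)
Lemma Xdp_val_nat d m : (0 < d)%N -> Xdp_val C (Xdp_nat d p m) = m%:R.
Proof.
move=> d0; apply: (abs_limE hv); apply: abs_cvg_near (abs_cvg_cst hv m%:R).
exists m => // N /= mN; rewrite modn_small//.
apply: (leq_ltn_trans mN); apply: (leq_trans (ltn_expl N (prime_gt1 p_prime))).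
by rewrite leq_pmull.
Qed.

Lemma padic_int_val_nat m : padic_int_val (padic_int_nat C m) = m%:R.
Proof. by rewrite /padic_int_val /Cp_of_Qp /= !rmorph_nat. Qed.

Lemma qBernoulli_chi1 n : qBernoulli_chi 1 (fun=> 1) q n = qBernoulli q n.
Proof.
rewrite /qBernoulli_chi qBernoulli_chi_gfE /qBernoulli /qBernoulli_gf.
rewrite big_nat1 mulr1 expr1; congr (_ * _).
by rewrite mulrC -[fps_const 1]/(1 : fps C) mul1r.
Qed.

End Integral.

Theorem theorem2 (R : realType) (p : nat) (C : padic_complex R p) (q : C)
    (d : nat) (chi : nat -> C) (n : nat)
    (p_prime : prime p) (p_odd : odd p)
    (q_near1 : Cp_abs (q - 1) < 1) (log_neq0 : padic_log q != 0)
    (d_gt0 : (0 < d)%N) (p_coprime_d : coprime p d)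
    (chi_char : dirichlet_character d chi) (chi_cond : is_conductor d chi d)
    (n_gt0 : (0 < n)%N) :
  is_X_integral q (fun x : Xdp d p => Xdp_chi chi x * Xdp_val C x ^+ n)
    ((q - 1) / padic_log q * qBernoulli_chi d chi q n)
  /\
  is_Zp_integral q (fun x : padic_int C => padic_int_val x ^+ n)
    ((q - 1) / padic_log q * qBernoulli q n).
Proof.
have cvg := periodic_integral_cvg p_prime q_near1 log_neq0.
split.
  (* [Xdp_chi] evaluates [chi] at the residue modulo [d * p ^ 0], whereas the limit lemma has
     [chi x] itself. *)
  have chiD x : chi (x %% d)%N = chi x.
    rewrite [in RHS](divn_eq x d) addnC; elim: (x %/ d)%N => [|k IH].
      by rewrite addn0.
    by rewrite mulSn addnCA addnC (dirichlet_periodic chi_char).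
  apply: abs_cvg_near (cvg d chi n d_gt0 (dirichlet_periodic chi_char)).
  apply: nearW => N; congr (_ * _); apply: eq_bigr => x _.
  by rewrite (Xdp_val_nat p_prime)// /Xdp_chi /= expn0 muln1 chiD.
have := cvg 1%N (fun=> 1) n isT (fun=> erefl).
rewrite (qBernoulli_chi1 p_prime); apply: abs_cvg_near; apply: nearW => N.
rewrite mul1n; congr (_ * _); apply: eq_bigr => x _.
by rewrite padic_int_val_nat mul1r.
Qed.
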